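(* Let $I$ be a set, let $A$ be an $I$-dimensional cylindric ortholattice and let $X_A$ be its Goldblatt frame. Let $\phi\colon A\to\mathcal{B}(X_A)$ be $\phi(a)=\{x\in\mathfrak{F}(A):a\in x\}$. Then $\langle\phi;\mathcal{B}(X_A)\rangle$ is a canonical completion of $A$.
   Context: An ortholattice is a bounded lattice $\langle A;\wedge,\vee,0,1\rangle$ with a unary operation ${}^{\perp}$ such that $a\wedge a^{\perp}=0$, $a\vee a^{\perp}=1$, $a\le b\Rightarrow b^{\perp}\le a^{\perp}$, and $a^{\perp\perp}=a$. A quantifier on an ortholattice $A$ is a map $\exists\colon A\to A$ with $\exists(a\vee b)=\exists a\vee\exists b$, $\exists 0=0$, $\exists\exists a=\exists a$, $a\le\exists a$, $\exists(\exists a)^{\perp}=(\exists a)^{\perp}$. An $I$-dimensional cylindric ortholattice is an ortholattice $A$ with unary operators $(\exists_i)_{i\in I}$ and constants $(\delta_{i,k})_{i,k\in I}$ such that for all $i,k,l\in I$: (1) $\exists_i$ is a quantifier; (2) $\exists_i\exists_k a=\exists_k\exists_i a$ for all $a\in A$; (3) $\delta_{i,k}=\delta_{k,i}$ and $\delta_{i,i}=1$; (4) if $i\neq k$ and $l\ne k$, then $\exists_k(\delta_{i,k}\wedge\delta_{k,l})=\delta_{i,l}$. The Goldblatt frame of $A$ is $X_A=\langle\mathfrak{F}(A);\perp,(R_i)_{i\in I},(\Delta_{i,k})_{i,k\in I}\rangle$, where $\mathfrak{F}(A)$ is the set of all non-empty proper filters of $A$; $x\perp y$ iff there is $a\in x$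 with $a^{\perp}\in y$; $xR_iy$ iff $\exists_i[x]=\{\exists_i a:a\in x\}\subseteq y$; $\Delta_{i,k}=\{x\in\mathfrak{F}(A):\delta_{i,k}\in x\}$. For $U\subseteq\mathfrak{F}(A)$ put $U^{\perp}=\{x: x\perp y\text{ for all }y\in U\}$; $U$ is biorthogonally closed if $U=U^{\perp\perp}$, and $\mathcal{B}(X_A)$ is the set of biorthogonally closed subsets of $\mathfrak{F}(A)$, a complete lattice under inclusion with meet $\cap$ and join $U\sqcup V=(U\cup V)^{\perp\perp}$. For a bounded lattice $A$, a canonical completion of $A$ is a pair $\langle e;C\rangle$ with $C$ a complete lattice and $e\colon A\to C$ a (bounded lattice) embedding that is dense (every element of $C$ is both a meet of joins and a join of meets of elements of $e[A]$) and compact (for all $S,T\subseteq A$ there are finite $S'\subseteq S$, $T'\subseteq T$ such that $\bigwedge e[S]\le\bigvee e[T]$ implies $\bigwedge e[S']\le\bigvee e[T']$). *)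

(* Defs.v *)
From HB Require Import structures.
From mathcomp Require Import all_boot all_order.
From mathcomp Require Import boolp classical_sets functions cardinality.

Set Implicit Arguments.
Unset Strict Implicit.
Unset Printing Implicit Defensive.

Import Order.TTheory.

Local Open Scope classical_set_scope.

HB.mixin Record TBLattice_hasOrthocomplement d T of Order.TBLattice d T := {
  perp : T -> T;
  meet_perp : forall a : T, Order.meet a (perp a) = Order.bottom;
  join_perp : forall a : T, Order.join a (perp a) = Order.top;
  perp_anti : forall a b : T, (a <= b)%O -> (perp b <= perp a)%O;
  perpK : forall a : T, perp (perp a) = a
}.

#[short(type="ortholatticeType")]
HB.structure Definition Ortholattice d :=
  { T of Order.TBLattice d T & TBLattice_hasOrthocomplement d T }.

Record quantifier d (A : ortholatticeType d) (f : A -> A) : Prop := {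
  quantifierU : forall a b, f (Order.join a b) = Order.join (f a) (f b);
  quantifier0 : f Order.bottom = Order.bottom;
  quantifier_idem : forall a, f (f a) = f a;
  quantifier_incr : forall a, (a <= f a)%O;
  quantifier_perp : forall a, f (perp (f a)) = perp (f a)
}.

HB.mixin Record Ortholattice_isCylindric (I : Type) d T
    of Ortholattice d T := {
  cyl : I -> T -> T;
  diag : I -> I -> T;
  cyl_quantifier : forall i, quantifier (cyl i);
  cylC : forall i k a, cyl i (cyl k a) = cyl k (cyl i a);
  diagC : forall i k, diag i k = diag k i;
  diagxx : forall i, diag i i = Order.top;
  cyl_diag : forall i k l, i <> k -> l <> k ->
    cyl k (Order.meet (diag i k) (diag k l)) = diag i l
}.

#[short(type="cylOrtholatticeType")]
HB.structure Definition CylOrtholattice (I : Type) d :=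
  { T of Ortholattice d T & Ortholattice_isCylindric I d T }.

HB.mixin Record TBLattice_isComplete d T of Order.TBLattice d T := {
  bigmeet : set T -> T;
  bigjoin : set T -> T;
  bigmeetP : forall S : set T, infimums S (bigmeet S);
  bigjoinP : forall S : set T, supremums S (bigjoin S)
}.

#[short(type="completeLatticeType")]
HB.structure Definition CompleteLattice d :=
  { T of Order.TBLattice d T & TBLattice_isComplete d T }.

Section CanonicalCompletion.
Context {d d' : Order.disp_t}.
Context {A : tbLatticeType d} {C : completeLatticeType d'}.
Variable e : A -> C.

Record blattice_embedding : Prop := {
  embedding_inj : injective e;
  embedding_meet : Order.meet_morphism e;
  embedding_join : Order.join_morphism e;
  embedding_bottom : e Order.bottom = Order.bottom;
  embedding_top : e Order.top = Order.top
}.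

Definition completion_dense : Prop := forall c : C,
  (exists F : set (set A), c = bigmeet [set bigjoin (e @` S) | S in F]) /\
  (exists F : set (set A), c = bigjoin [set bigmeet (e @` S) | S in F]).

Definition completion_compact : Prop := forall S T : set A,
  exists S' T' : set A,
    [/\ finite_set S' /\ S' `<=` S, finite_set T' /\ T' `<=` T &
      (bigmeet (e @` S) <= bigjoin (e @` T))%O ->
      (bigmeet (e @` S') <= bigjoin (e @` T'))%O].

Record canonical_completion : Prop := {
  completion_embedding : blattice_embedding;
  completion_isdense : completion_dense;
  completion_iscompact : completion_compact
}.

End CanonicalCompletion.

Record cyl_frame (I : Type) := CylFrame {
  point :> Type;
  orth : point -> point -> Prop;
  orth_irr : forall x : point, ~ orth x x;
  orth_sym : forall x y, orth x y -> orth y x;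
  acc : I -> point -> point -> Prop;
  diagonal : I -> I -> set point
}.

Section Biorthogonal.
Context {I : Type} {X : cyl_frame I}.
Implicit Types U V : set X.

Definition orthoset U : set X := [set x | forall y, U y -> orth x y].

Lemma orthosetS U V : U `<=` V -> orthoset V `<=` orthoset U.
Proof. by move=> UV x Vx y /UV; apply: Vx. Qed.

Lemma sub_biorth U : U `<=` orthoset (orthoset U).
Proof. by move=> x Ux y /(_ _ Ux) /orth_sym. Qed.

Lemma orthoset3 U : orthoset (orthoset (orthoset U)) = orthoset U.
Proof.
by apply/seteqP; split; [apply/orthosetS/sub_biorth | apply: sub_biorth].
Qed.

End Biorthogonal.

(* Biorthogonally closed sets; the asbool brackets only serve to make the
   condition a boolean, as the subType interface requires. *)
Record bclosed (I : Type) (X : cyl_frame I) := BClosed {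
  bset :> set X;
  _ : `[< bset = orthoset (orthoset bset) >]
}.

HB.instance Definition _ I (X : cyl_frame I) := [isSub for @bset I X].
HB.instance Definition _ I (X : cyl_frame I) := [Choice of bclosed X by <:].

Section BclosedLattice.
Context {I : Type} {X : cyl_frame I}.
Implicit Types U V W : bclosed X.

Lemma bsetE U : orthoset (orthoset U) = U.
Proof. by case: U => U /= /asboolP. Qed.

Lemma bset_inj : injective (@bset I X).
Proof. exact: val_inj. Qed.

Definition bhull (S : set X) : bclosed X :=
  BClosed (introT (asboolP _) (esym (orthoset3 (orthoset S)))).

Lemma bhull_sub (S : set X) U : (bhull S `<=` U) <-> (S `<=` U).
Proof.
split=> [h x /sub_biorth/h //|SU]; rewrite -(bsetE U).
exact/orthosetS/orthosetS.
Qed.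

Lemma bcap_closed (F : set (bclosed X)) :
  `[< \bigcap_(U in F) (U : set X) =
      orthoset (orthoset (\bigcap_(U in F) (U : set X))) >].
Proof.
apply/asboolP/seteqP; split; first exact: sub_biorth.
move=> x hx U FU; rewrite -(bsetE U).
by move: x hx; do 2 apply: orthosetS; apply: bigcap_inf.
Qed.

Definition bcap (F : set (bclosed X)) : bclosed X := BClosed (bcap_closed F).

Definition ble U V : bool := `[< U `<=` V >].

Lemma ble_refl : reflexive ble.
Proof. by move=> U; apply/asboolP. Qed.

Lemma ble_anti : antisymmetric ble.
Proof.
by move=> U V /andP[/asboolP UV /asboolP VU]; apply/bset_inj/seteqP.
Qed.

Lemma ble_trans : transitive ble.
Proof.
by move=> V U W /asboolP UV /asboolP VW; apply/asboolP/(subset_trans UV).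
Qed.

End BclosedLattice.

Fact bclosed_display : Order.disp_t. Proof. exact: Order.Disp. Qed.

Section BclosedInstances.
Context {I : Type} {X : cyl_frame I}.
Implicit Types U V W : bclosed X.

HB.instance Definition _ := Order.Le_isPOrder.Build bclosed_display
  (bclosed X) ble_refl ble_anti ble_trans.

Lemma bleP U V : reflect (U `<=` V) (U <= V)%O.
Proof. exact: asboolP. Qed.

Lemma bmeet_closed U V : `[< U `&` V = orthoset (orthoset (U `&` V)) >].
Proof.
apply/asboolP/seteqP; split; first exact: sub_biorth.
move=> x hx; split; [rewrite -(bsetE U)|rewrite -(bsetE V)];
  by move: x hx; apply: orthosetS; apply: orthosetS => x [].
Qed.

Definition bmeet U V : bclosed X := BClosed (bmeet_closed U V).

Definition bjoin U V : bclosed X := bhull (U `|` V).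

Lemma lebI U V W : (U <= bmeet V W)%O = (U <= V)%O && (U <= W)%O.
Proof.
apply/bleP/andP => [h|[/bleP UV /bleP UW] x Ux]; last by split; auto.
by split; apply/bleP => x /h[].
Qed.

Lemma lebU U V W : (bjoin U V <= W)%O = (U <= W)%O && (V <= W)%O.
Proof.
apply/bleP/andP => [/bhull_sub h|[/bleP UW /bleP VW]].
  by split; apply/bleP => x Ux; apply: h; [left|right].
by apply/bhull_sub => x [/UW|/VW].
Qed.

HB.instance Definition _ := Order.POrder_isMeetSemilattice.Build
  bclosed_display (bclosed X) lebI.
HB.instance Definition _ := Order.POrder_isJoinSemilattice.Build
  bclosed_display (bclosed X) lebU.

Lemma bbottomP U : (bhull set0 <= U)%O.
Proof. exact/bleP/bhull_sub. Qed.

Lemma btopP U : (U <= bhull setT)%O.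
Proof. by apply/bleP => x _; apply: sub_biorth. Qed.

HB.instance Definition _ := Order.hasBottom.Build
  bclosed_display (bclosed X) bbottomP.
HB.instance Definition _ := Order.hasTop.Build
  bclosed_display (bclosed X) btopP.

Definition bcup (F : set (bclosed X)) : bclosed X :=
  bhull (\bigcup_(U in F) (U : set X)).

Lemma bcapP (F : set (bclosed X)) : infimums F (bcap F).
Proof.
split=> [U FU|U hU]; apply/bleP; first exact: bigcap_inf.
by move=> x Ux V FV; move/bleP: (hU V FV); apply.
Qed.

Lemma bcupP (F : set (bclosed X)) : supremums F (bcup F).
Proof.
split=> [U FU|U hU]; apply/bleP.
  by move=> x Ux; apply: sub_biorth; exists U.
by apply/bhull_sub => x [V FV Vx]; move/bleP: (hU V FV); apply.
Qed.

HB.instance Definition _ := TBLattice_isComplete.Build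
  bclosed_display (bclosed X) bcapP bcupP.

End BclosedInstances.

Record proper_filter d (A : tbLatticeType d) := ProperFilter {
  filter_set : set A;
  filter_nonempty : filter_set !=set0;
  filter_up : forall a b, filter_set a -> (a <= b)%O -> filter_set b;
  filter_meet : forall a b,
    filter_set a -> filter_set b -> filter_set (Order.meet a b);
  filter_proper : filter_set <> setT
}.

Section GoldblattFrame.
Context {I : Type} {d : Order.disp_t} {A : cylOrtholatticeType I d}.
Implicit Types x y : proper_filter A.

Lemma filter_bottom x : ~ filter_set x Order.bottom.
Proof.
move=> x0; apply: (filter_proper (p := x)); apply/seteqP; split=> // a _.
exact/(filter_up x0)/le0x.
Qed.

Definition filter_orth x y : Prop := exists2 a, filter_set x a & filter_set y (perp a).

Lemma filter_orth_irr x : ~ filter_orth x x.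
Proof.
move=> [a xa xa']; apply: (@filter_bottom x).
by rewrite -(meet_perp a); apply: filter_meet.
Qed.

Lemma filter_orth_sym x y : filter_orth x y -> filter_orth y x.
Proof. by move=> [a xa ya]; exists (perp a); rewrite ?perpK. Qed.

Definition goldblatt_frame : cyl_frame I := {|
  point := proper_filter A;
  orth := filter_orth;
  orth_irr := filter_orth_irr;
  orth_sym := filter_orth_sym;
  acc := fun i x y => cyl i @` filter_set x `<=` filter_set y;
  diagonal := fun i k => [set x : proper_filter A | filter_set x (diag i k)]
|}.

End GoldblattFrame.

Arguments goldblatt_frame {I d} A.

Section Phi.
Context {I : Type} {d : Order.disp_t} {A : cylOrtholatticeType I d}.

Definition phi_set (a : A) : set (goldblatt_frame A) :=
  [set x : proper_filter A | filter_set x a].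

Lemma phi_set_perp (a : A) : phi_set a = orthoset (phi_set (perp a)).
Proof.
apply/seteqP; split=> [x xa y ya|x xa]; first by exists a.
have [a0|/eqP a0] := eqVneq (perp a) Order.bottom.
  have [b xb] := filter_nonempty (x : proper_filter A).
  by apply: (filter_up xb); rewrite -(perpK a) a0 -(perpK b) perp_anti ?le0x.
have up b c : (perp a <= b)%O -> (b <= c)%O -> (perp a <= c)%O.
  exact: le_trans.
have meet b c : (perp a <= b)%O -> (perp a <= c)%O ->
    (perp a <= Order.meet b c)%O.
  by move=> ab ac; rewrite lexI ab.
have proper : [set b | (perp a <= b)%O] <> setT.
  by move=> /seteqP[_ /(_ Order.bottom Logic.I)] /=; rewrite lex0 => /eqP.
have nonempty : [set b | (perp a <= b)%O] !=set0 by exists (perp a) => /=.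
pose y := @ProperFilter d A [set b | (perp a <= b)%O]
  nonempty up meet proper.
have [b xb /perp_anti] := xa y (lexx (perp a)).
by rewrite !perpK; apply: filter_up.
Qed.

Lemma phi_closed (a : A) :
  `[< phi_set a = orthoset (orthoset (phi_set a)) >].
Proof. by apply/asboolP; rewrite (phi_set_perp a) orthoset3. Qed.

Definition phi (a : A) : bclosed (goldblatt_frame A) := BClosed (phi_closed a).

End Phi.

(* Main.v *)
Require Import Defs.
From mathcomp Require Import all_boot all_order.
From mathcomp Require Import boolp classical_sets cardinality.

(** Why the theorem holds.  Write [F(S)] for the filter generated by [S].

    Compactness carries the proof.  Suppose [F(S)] and [F(perp T)] are both
    proper.  The first is a point of the intersection of the [phi s], [s] in
    [S]; the second is orthogonal to every filter meeting [T].  Hence, if that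
    intersection lies below the join of the [phi t], the two filters are
    orthogonal: some [a] lies in [F(S)] with [perp a] in [F(perp T)], so [a]
    is above a finite meet from [S] and, by De Morgan, below a finite join
    from [T].  When one of the two filters is improper, [a = 0] or [a = 1]
    does the same (lemma [phi_compact]).  The case of two singletons says that
    [phi] reflects the order, hence is injective.

    Joins are preserved because [phi a] is the orthocomplement of
    [phi (perp a)], which turns joins into meets, i.e. intersections.

    Density comes from the points.  A closed set [U] is upward closed for
    inclusion of filters, and the filters including [x] form the meet of the
    [phi a], [a] in [x]; so [U] is the union of these meets over [x] in [U].
    Dually [U] is the intersection of the sets of points orthogonal to [y],
    for [y] orthogonal to [U], and such a set is the union of the
    [phi (perp a)], [a] in [y]. *)

Set Implicit Arguments.
Unset Strict Implicit.
Unset Printing Implicit Defensive.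

Import Order.TTheory.

Local Open Scope classical_set_scope.
Local Open Scope order_scope.

(** * De Morgan laws in an ortholattice *)

Section Orthocomplement.
Context {d : Order.disp_t} {A : ortholatticeType d}.
Implicit Types a b : A.

Lemma perp_le_swap a b : perp a <= b -> perp b <= a.
Proof. by move=> /perp_anti; rewrite perpK. Qed.

Lemma perp_top : perp (\top : A) = \bot.
Proof. by rewrite -[LHS]meet1x meet_perp. Qed.

Lemma perp_bottom : perp (\bot : A) = \top.
Proof. by rewrite -perp_top perpK. Qed.

Lemma perp_meet a b : perp (a `&` b) = perp a `|` perp b.
Proof.
apply/le_anti; rewrite leUx !perp_anti ?leIl ?leIr ?andbT //.
by apply: perp_le_swap; rewrite lexI; apply/andP; split;
  apply: perp_le_swap; rewrite ?leUl ?leUr.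
Qed.

Lemma perp_join a b : perp (a `|` b) = perp a `&` perp b.
Proof. by rewrite -[RHS]perpK perp_meet !perpK. Qed.

Lemma perp_bigmeet (s : seq A) :
  perp (\meet_(a <- s) a) = \join_(a <- s) perp a.
Proof. exact: (big_morph perp perp_meet perp_top). Qed.

End Orthocomplement.

(** * Filters generated by a set *)

Section GeneratedFilter.
Context {d : Order.disp_t} {A : tbLatticeType d}.
Implicit Types (S : set A) (a b : A).

(** Finite subsets are lists here so that their meets are iterated meets; the
    empty list makes [\top] a member even when [S] is empty. *)
Definition generated_filter S : set A :=
  [set a | exists2 s : seq A, [set` s] `<=` S & \meet_(b <- s) b <= a].

Lemma generated_filter_sub S : S `<=` generated_filter S.
Proof.
move=> a Sa; exists [:: a]; last by rewrite big_seq1.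
by move=> b /=; rewrite inE => /eqP ->.
Qed.

Lemma generated_filter_top S : generated_filter S \top.
Proof. by exists [::]; rewrite ?lex1. Qed.

Lemma generated_filter_up S a b :
  generated_filter S a -> a <= b -> generated_filter S b.
Proof. by move=> [s sS sa] ab; exists s; last exact: le_trans ab. Qed.

Lemma generated_filter_meet S a b : generated_filter S a ->
  generated_filter S b -> generated_filter S (a `&` b).
Proof.
move=> [s sS sa] [t tS tb]; exists (s ++ t); last by rewrite big_cat leI2.
by move=> c /=; rewrite mem_cat => /orP[/sS|/tS].
Qed.

Lemma proper_generated_filter S : ~ generated_filter S \bot ->
  exists x : proper_filter A, filter_set x = generated_filter S.
Proof.
move=> S0; have proper : generated_filter S <> setT.
  by move=> ST; apply: S0; rewrite ST.
have nonempty : generated_filter S !=set0.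
  by exists \top; apply: generated_filter_top.
by exists (ProperFilter nonempty (@generated_filter_up S)
  (@generated_filter_meet S) proper).
Qed.

End GeneratedFilter.

(** * Meets and joins of biorthogonally closed sets *)

Section BclosedComplete.
Context {I : Type} {X : cyl_frame I}.
Implicit Types (U V : bclosed X) (F : set (bclosed X)).

Lemma orthoset_closed (S : set X) :
  `[< orthoset S = orthoset (orthoset (orthoset S)) >].
Proof. by apply/asboolP; rewrite orthoset3. Qed.

Lemma bset_bigmeet F : bset (bigmeet F) = \bigcap_(U in F) (U : set X).
Proof. by []. Qed.

Lemma bset_bigjoin F :
  bset (bigjoin F) = orthoset (orthoset (\bigcup_(U in F) (U : set X))).
Proof. by []. Qed.

(** A join is the biorthogonal hull of the union, and a closed set is its own
    hull. *)
Lemma bigjoin_bigcup F U :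
  bset U = \bigcup_(V in F) (V : set X) -> U = bigjoin F.
Proof. by move=> UF; apply: bset_inj; rewrite bset_bigjoin -UF bsetE. Qed.

Lemma le_bigjoin F U : F U -> U <= bigjoin F.
Proof. by have [ub _] := bigjoinP F; apply: ub. Qed.

Lemma bigmeet_le F U : F U -> bigmeet F <= U.
Proof. by have [lb _] := bigmeetP F; apply: lb. Qed.

End BclosedComplete.

Section Goldblatt.
Context {I : Type} {d : Order.disp_t} {A : cylOrtholatticeType I d}.
Notation X := (goldblatt_frame A).
Notation phi := (phi : A -> bclosed X).
Implicit Types (a b : A) (S T : set A) (x y : X) (U : bclosed X).

(** * The map phi is a lattice homomorphism *)

Lemma phi_meet : Order.meet_morphism phi.
Proof.
move=> a b; apply: bset_inj; apply/seteqP; split=> x.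
  by move=> xab; split; apply: (filter_up xab); rewrite ?leIl ?leIr.
by move=> [xa xb]; apply: filter_meet.
Qed.

Lemma phi_perp a : bset (phi (perp a)) = orthoset (bset (phi a)).
Proof. by rewrite /= phi_set_perp perpK. Qed.

(** Orthocomplementation in [A] and in the frame reduces this to
    [phi_meet]. *)
Lemma phi_join : Order.join_morphism phi.
Proof.
move=> a b; apply: bset_inj.
rewrite -[a `|` b]perpK phi_perp perp_join phi_meet.
have perpI : bset (phi (perp a) `&` phi (perp b)) =
    orthoset ((phi a : set X) `|` phi b)%classic.
  rewrite -[LHS]/(bset (phi (perp a)) `&` bset (phi (perp b)))%classic.
  rewrite !phi_perp; apply/seteqP; split=> x.
    by move=> [xa xb] y [/xa|/xb].
  by move=> xab; split=> y yab; apply: xab; [left|right].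
by rewrite perpI.
Qed.

Lemma phi_bottom : phi \bot = \bot.
Proof.
apply/le_anti; rewrite le0x andbT.
by apply/bleP => x /filter_bottom.
Qed.

Lemma phi_top : phi \top = \top.
Proof.
apply/le_anti; rewrite lex1; apply/bleP => x _.
by have [a xa] := filter_nonempty (x : proper_filter A);
  apply: (filter_up xa); rewrite lex1.
Qed.

(** * Compactness and injectivity *)

(** The points generated by [S] and by [perp @` T] are orthogonal, the first
    being in the meet and the second orthogonal to the join.  An improper
    filter contains [\bot] and [\top], and every generated filter contains
    [\top], so the conclusion persists when no such point exists. *)
Lemma orth_of_generated S T :
  bigmeet (phi @` S) <= bigjoin (phi @` T) ->
  exists2 a, generated_filter S a & generated_filter (perp @` T) (perp a).
Proof.
move=> /bleP ST.
have [S0|/proper_generated_filter[x xS]] := pselect (generated_filter S \bot).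
  by exists \bot; rewrite ?perp_bottom //; apply: generated_filter_top.
have [T0|/proper_generated_filter[y yT]] :=
    pselect (generated_filter (perp @` T) \bot).
  by exists \top; rewrite ?perp_top //; apply: generated_filter_top.
rewrite -xS -yT; apply: (ST x) => [_ [a Sa <-]|z [_ [b Tb <-]] zb].
  by rewrite /= /phi_set /= xS; apply: generated_filter_sub.
(* [b] and its orthocomplement witness the orthogonality of [z] and [y]. *)
apply: orth_sym; exists b => //=.
by rewrite yT; apply: generated_filter_sub; exists b.
Qed.

Lemma phi_compact S T : bigmeet (phi @` S) <= bigjoin (phi @` T) ->
  exists s t : seq A, [/\ [set` s] `<=` S, [set` t] `<=` T &
    \meet_(a <- s) a <= \join_(b <- t) b].
Proof.
move=> /orth_of_generated[a [s sS sa] [t tT ta]].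
exists s, (map perp t); split=> //.
  by move=> b /= /mapP[c /tT[b' Tb' <-] ->]; rewrite perpK.
by rewrite big_map -perp_bigmeet (le_trans sa) // -[a]perpK perp_anti.
Qed.

(** Compactness for two singletons: every finite meet from [[set a]], the empty
    one included, is above [a], and every finite join from [[set b]] is
    below [b]. *)
Lemma phi_le_reflect a b : phi a <= phi b -> a <= b.
Proof.
move=> ab; have [|s [t [sa tb st]]] := @phi_compact [set a] [set b].
  by apply: le_trans (bigmeet_le _) (le_trans ab (le_bigjoin _)); apply: imageP.
have as_ : a <= \meet_(c <- s) c.
  by rewrite big_seq; apply: meets_ge => c /= /sa ->.
have tb_ : \join_(c <- t) c <= b.
  by rewrite big_seq; apply: joins_le => c /= /tb ->.
exact: le_trans as_ (le_trans st tb_).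
Qed.

Lemma phi_inj : injective phi.
Proof. by move=> a b ab; apply/le_anti; rewrite !phi_le_reflect ?ab. Qed.

Lemma phi_embedding : blattice_embedding phi.
Proof.
split; [exact: phi_inj | exact: phi_meet | exact: phi_join |
  exact: phi_bottom | exact: phi_top].
Qed.

Lemma bigmeet_phi_le (s : seq A) :
  bigmeet (phi @` [set` s]) <= phi (\meet_(a <- s) a).
Proof.
rewrite (big_morph phi phi_meet phi_top) big_seq.
by apply: meets_ge => a sa; apply: bigmeet_le; apply: imageP.
Qed.

Lemma le_bigjoin_phi (s : seq A) :
  phi (\join_(a <- s) a) <= bigjoin (phi @` [set` s]).
Proof.
rewrite (big_morph phi phi_join phi_bottom) big_seq.
by apply: joins_le => a sa; apply: le_bigjoin; apply: imageP.
Qed.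

Lemma phi_le a b : a <= b -> phi a <= phi b.
Proof. by move=> ab; apply/bleP => x xa; apply: filter_up ab. Qed.

(** The finite sets are chosen according to whether the inequality to be
    reduced holds; if it fails, the implication is vacuous. *)
Lemma phi_completion_compact : completion_compact phi.
Proof.
move=> S T.
have [/phi_compact[s [t [sS tT st]]]|nST] :=
    pselect (bigmeet (phi @` S) <= bigjoin (phi @` T)).
  exists [set` s], [set` t]; split=> [||_].
  - by split; [exact: finite_seq|].
  - by split; [exact: finite_seq|].
  exact: le_trans (bigmeet_phi_le s) (le_trans (phi_le st) (le_bigjoin_phi t)).
by exists set0, set0; split=> [||/nST //]; split.
Qed.

(** * Density *)

Lemma bset_bigmeet_filter x :
  bset (bigmeet (phi @` filter_set x)) =
  [set y : X | filter_set x `<=` filter_set y].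
Proof.
rewrite bset_bigmeet bigcap_image.
by apply/seteqP; split.
Qed.

(** By the definition of orthogonality, the filters orthogonal to [x] are those
    containing some [perp a] with [a] in [x]; this union is closed, being an
    orthoset. *)
Lemma bset_bigjoin_perp_filter x :
  bset (bigjoin (phi @` (perp @` filter_set x))) = orthoset [set x].
Proof.
rewrite -[RHS]/(bset (BClosed (orthoset_closed [set x]))).
congr bset; apply/esym/bigjoin_bigcup.
apply/seteqP; split=> [y /(_ x erefl) /orth_sym[a xa ya]|].
  by exists (phi (perp a)) => //; exists (perp a) => //; exists a.
move=> y [_ [_ [a xa <-] <-] ya] _ ->.
by apply: orth_sym; exists a.
Qed.

(** Orthogonality to a given point is inherited by larger filters. *)
Lemma bclosed_filter_up U x y :
  bset U x -> filter_set x `<=` filter_set y -> bset U y.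
Proof.
rewrite -(bsetE U) => Ux xy z /Ux[a xa za].
by exists a => //; apply: xy.
Qed.

Lemma phi_dense : completion_dense phi.
Proof.
move=> U; split.
  exists [set perp @` filter_set x | x in orthoset U].
  apply: bset_inj; rewrite bset_bigmeet !bigcap_image.
  under eq_bigcapr do rewrite bset_bigjoin_perp_filter.
  rewrite -{1}(bsetE U); apply/seteqP; split=> y hy x.
    by move=> /hy yx _ ->.
  by move=> /hy; apply.
exists [set filter_set x | x in bset U].
apply: bigjoin_bigcup; rewrite !bigcup_image.
apply/seteqP; split=> [x Ux|y [x Ux]].
  by exists x => //; rewrite bset_bigmeet_filter.
by rewrite bset_bigmeet_filter => /= xy; apply: bclosed_filter_up Ux xy.
Qed.

End Goldblatt.

Theorem theorem3p6 (I : Type) (d : Order.disp_t)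
    (A : cylOrtholatticeType I d) :
  canonical_completion (phi : A -> bclosed (goldblatt_frame A)).
Proof.
by split; [exact: phi_embedding | exact: phi_dense |
  exact: phi_completion_compact].
Qed.
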